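(* For all nonnegative integers $k$ and $n$ with $k \geq 2$ and $n \neq 1$, we have $$\mathrm{As}_n^{(k)} = 2^{n-2} \sum_{\ell=0}^{+\infty} \left[\binom{(k+1)\ell-n}{\ell} - \binom{(k+1)\ell-n}{\ell-1}\right] 2^{-(k+1)\ell} .$$
   Context: For an integer $k \geq 2$, $\rho_k$ denotes the unique complex root of modulus greater than $1$ of the equation $x^k = x^{k-1} + x^{k-2} + \dots + x + 1$; it is known that this root exists and is unique, is real and lies in the interval $(1,2)$. For every integer $k \geq 2$ and every integer $n \geq 0$, define $$\mathrm{As}_n^{(k)} := \frac{\rho_k - 1}{(k+1)\rho_k - 2k}\, \rho_k^{n-1} .$$ For $a, b \in \mathbb{Z}$, the generalized binomial coefficient is defined by $\binom{a}{b} := \frac{a(a-1)\cdots(a-b+1)}{b!}$ if $b \geq 0$; $\binom{a}{b} := \binom{a}{a-b}$ if $b < 0$ and $a \geq b$; and $\binom{a}{b} := 0$ if $a < b < 0$. *)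

(* Defs.v *)
From mathcomp Require Import all_boot all_order all_algebra.
From mathcomp Require Import complex.
From mathcomp Require Import all_classical all_reals all_analysis.
Set Implicit Arguments.
Unset Strict Implicit.
Unset Printing Implicit Defensive.
Import Order.TTheory GRing.Theory Num.Theory.
Import numFieldNormedType.Exports.
Local Open Scope classical_set_scope.
Local Open Scope ring_scope.

(* The set is a singleton when [2 <= k]; otherwise [rho R k] is irrelevant. *)
Definition rho (R : realType) (k : nat) : R[i] :=
  xget 0 [set z : R[i] | z ^+ k = \sum_(i < k) z ^+ i /\ 1 < `|z|].

(* Powers here have an integer exponent, since [n - 1] may be negative. *)
Definition As (R : realType) (k n : nat) : R[i] :=
  (rho R k - 1) / (k.+1%:R * rho R k - (2 * k)%:R) * rho R k ^ (n%:Z - 1).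

Definition falling_binomial (F : fieldType) (a : int) (m : nat) : F :=
  (\prod_(i < m) (a%:~R - i%:R)) / m`!%:R.

(* In both calls the argument of the absolute value is nonnegative. *)
Definition gbinomial (F : fieldType) (a b : int) : F :=
  if 0 <= b then falling_binomial F a `|b|%N
  else if b <= a then falling_binomial F a `|a - b|%N
  else 0.

(* Main.v *)
Require Import Defs.
From mathcomp Require Import all_boot all_order all_algebra.
From mathcomp Require Import complex ring lra zify.
From mathcomp Require Import all_classical all_reals all_analysis.
Import Order.TTheory GRing.Theory Num.Theory.
Import numFieldNormedType.Exports.
Local Open Scope classical_set_scope.
Local Open Scope ring_scope.

(** Put r = k + 1 and b = 1 / rho. Clearing denominators in the equation of
    rho gives b + b^2 + ... + b^k = 1, whence b^r = 2 b - 1. There is exactly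
    one such b of modulus less than 1, and it is a real number in (0, 1).

    The theorem is an instance of the generalized binomial series
    T(s) = sum_l C(r l + s, l) x^l at x = 2^-r, where C is the polynomial
    binomial coefficient: classically T(s) = B^s / (1 - r + r / B) with
    B = 1 + x B^r, and here B = 2 b. The series of the statement is
    T(-n) - x T(r - n), because the term with lower index -1 vanishes when
    n <> 1; the factor 1 - x B^r = 2 - 2 b then produces the formula.

    The evaluation of T(s) is elementary, without generating functions.
    Pascal's rule gives T(s + 1) = T(s) + x T(s + r), so V(s) = T(s) / 2^s
    satisfies the recurrence V(s + r) = 2 V(s + 1) - V(s). Its characteristic
    polynomial z^r - 2 z + 1 has the root b, and dividing z - b out shows that
    E(s) = V(s + 1) - b V(s) is a weighted average of E(s + 1), ..., E(s + k)
    with positive weights ([null_trinomial_recurrence]). A sequence which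
    averages its future values and tends to 0 vanishes
    ([backward_average_eq0]). The bound C(m, l) <= (3/2)^m 2^l makes V tend
    to 0, so that V(s) = V(0) b^s and T(s) = T(0) (2 b)^s for s >= 0; the
    recurrence run downwards extends this to all integers s.

    The constant comes from C(r l, l) = r C(r l - 1, l - 1), that is
    T(0) = 1 + r x T(k) = 1 + r x T(0) (2 b)^k. *)

(** * The root of the characteristic equation *)

(** Multiply the geometric sum by [w - 1]. *)
Lemma geometric_root_trinomial (F : comPzRingType) (k : nat) (w : F) :
  \sum_(i < k) w ^+ i.+1 = 1 -> w ^+ k.+1 = 2 * w - 1.
Proof.
move=> sw; have : (w - 1) * \sum_(i < k) w ^+ i.+1 = w * (w ^+ k - 1).
  rewrite subrX1 mulrCA; congr (_ * _); rewrite mulr_sumr.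
  by apply: eq_bigr => i _; rewrite exprS.
rewrite sw mulr1 mulrBr -exprS => h; rewrite -[LHS](subrK (w * 1)) -h; ring.
Qed.

(** The coefficients of [(z ^+ k.+1 - 2 * z + 1) / (z - b)] are the powers of
    [b], up to subtracting 2 from the constant one. This evaluates the sum of
    the other coefficients, which serve as weights of an average below. *)
Lemma geometric_root_weights (F : fieldType) (k : nat) (b : F) : b != 0 ->
  \sum_(i < k) b ^+ i.+1 = 1 -> \sum_(i < k) b ^+ (k.-1 - i) = 2 - b ^+ k.
Proof.
move=> b0 sb; apply: (mulfI b0).
rewrite mulrBr -exprS (geometric_root_trinomial _ _ _ sb).
transitivity (\sum_(i < k) b ^+ i.+1); last by rewrite sb; ring.
rewrite mulr_sumr (reindex_inj rev_ord_inj) /=; apply: eq_bigr => i _.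
by rewrite -exprS; congr (_ ^+ _); case: i => i /=; lia.
Qed.

Lemma geometric_root_exists (R : rcfType) (k : nat) : (2 <= k)%N ->
  exists b : R, [/\ 0 < b, b < 1 & \sum_(i < k) b ^+ i.+1 = 1].
Proof.
move=> hk; pose p : {poly R} := \sum_(i < k) 'X^(i.+1) - 1.
have pE x : p.[x] = \sum_(i < k) x ^+ i.+1 - 1.
  rewrite /p !hornerE horner_sum; congr (_ - _).
  by apply: eq_bigr => i _; rewrite hornerXn.
have p1 : \sum_(i < k) (1 : R) ^+ i.+1 = k%:R.
  rewrite (eq_bigr (fun=> 1)) ?sumr_const ?card_ord // => i _.
  by rewrite expr1n.
have p0 : \sum_(i < k) (0 : R) ^+ i.+1 = 0.
  by rewrite big1 // => i _; rewrite expr0n.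
have [||b /andP[b0 b1] /rootP] := @poly_ivt R p 0 1.
- exact: ler01.
- by rewrite !pE p1 p0 sub0r lerN10 subr_ge0 ler1n; lia.
rewrite pE => /eqP; rewrite subr_eq0 => /eqP sb; exists b; split => //.
- rewrite lt_neqAle b0 andbT; apply/eqP => b0'.
  by move: sb; rewrite -b0' p0 => /eqP; rewrite eq_sym oner_eq0.
- rewrite lt_neqAle b1 andbT; apply/eqP => b1'.
  by move: sb; rewrite b1' p1 => /eqP; rewrite pnatr_eq1; lia.
Qed.

(** If [w] and [b] were distinct, dividing the difference of their trinomial
    equations by [b - w] would make the average of the powers [w ^+ i.+1],
    for the positive weights [b ^+ (k.-1 - i)], equal to 1; but all these
    powers have modulus less than 1. *)
Lemma geometric_root_unique (F : numFieldType) (k : nat) (b w : F) :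
  (2 <= k)%N -> 0 < b -> `|w| < 1 -> \sum_(i < k) b ^+ i.+1 = 1 ->
  \sum_(i < k) w ^+ i.+1 = 1 -> w = b.
Proof.
move=> hk b0 w1 sb sw; apply/eqP/negPn/negP => wb.
have bw : b - w != 0 by rewrite subr_eq0 eq_sym.
have : \sum_(i < k.+1) b ^+ (k - i) * w ^+ i = 2.
  apply: (mulfI bw); rewrite -(subrXX b w k.+1).
  rewrite (geometric_root_trinomial _ _ _ sb).
  by rewrite (geometric_root_trinomial _ _ _ sw); ring.
rewrite big_ord_recl /= subn0 expr0 mulr1 => h.
have eW : \sum_(i < k) b ^+ (k.-1 - i) * w ^+ i.+1 = \sum_(i < k) b ^+ (k.-1 - i).
  rewrite (geometric_root_weights _ _ _ (lt0r_neq0 b0) sb) -h addrAC subrr add0r.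
  by apply: eq_bigr => i _; rewrite /bump add1n -subn1 -subnDA add1n.
have bi (i : 'I_k) : 0 < b ^+ (k.-1 - i) by rewrite exprn_gt0.
have : `|\sum_(i < k) b ^+ (k.-1 - i)| < \sum_(i < k) b ^+ (k.-1 - i).
  rewrite -{1}eW; apply: (le_lt_trans (ler_norm_sum _ _ _)).
  apply: ltr_sum => [|i _].
    by apply/hasP; exists (Ordinal (ltnW hk)); rewrite ?mem_index_enum.
  rewrite normrM (gtr0_norm (bi i)) normrX -[ltRHS]mulr1 ltr_pM2l //.
  by rewrite exprn_ilt1.
by rewrite ger0_norm ?ltxx // sumr_ge0 // => i _; exact: ltW.
Qed.

Lemma rho_geometric_root (R : realType) (k : nat) (b : R) :
  (2 <= k)%N -> 0 < b -> b < 1 -> \sum_(i < k) b ^+ i.+1 = 1 ->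
  rho R k = (b^-1)%:C%C.
Proof.
move=> hk b0 b1 sb.
have inv_root (F : fieldType) (z : F) : z != 0 ->
    z ^+ k = \sum_(i < k) z ^+ i <-> \sum_(i < k) z^-1 ^+ i.+1 = 1.
  move=> z0; have -> : \sum_(i < k) z ^+ i = z ^+ k * \sum_(i < k) z^-1 ^+ i.+1.
    rewrite mulr_sumr (reindex_inj rev_ord_inj) /=; apply: eq_bigr => i _.
    by rewrite exprVn -expfB_cond ?(negbTE z0) ?ltn_ord.
  split=> [/esym h|->]; last by rewrite mulr1.
  by apply: (mulfI (expf_neq0 k z0)); rewrite h mulr1.
have bC0 : 0 < b%:C%C by rewrite ltcR.
have sbC : \sum_(i < k) (b%:C%C : R[i]) ^+ i.+1 = 1.
  rewrite -[1](rmorph1 (real_complex R)) -sb rmorph_sum.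
  by apply: eq_bigr => i _; rewrite rmorphXn.
apply: xget_unique => [|z [ez z1]].
  rewrite fmorphV /=; split.
    by apply/inv_root; rewrite ?invr_eq0 ?gt_eqF ?invrK.
  by rewrite normfV invf_gt1 ?normr_gt0 ?gt_eqF // gtr0_norm // ltcR.
have z0 : z != 0 by rewrite -normr_gt0 (lt_trans ltr01).
rewrite fmorphV /=; apply: invr_inj; rewrite invrK.
apply: geometric_root_unique hk bC0 _ sbC _; last exact/inv_root.
by rewrite normfV invf_lt1 // normr_gt0.
Qed.

(** * Polynomial binomial coefficients *)

Lemma falling_binomial0 (F : fieldType) (a : int) : falling_binomial F a 0 = 1.
Proof. by rewrite /falling_binomial big_ord0 fact0 divr1. Qed.

(** This gives Pascal's rule for an upper index of any sign, and at a
    multiple of the lower index it fixes the constant of the series. *)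
Lemma falling_binomial_absorption (F : numFieldType) (a : int) (m : nat) :
  m.+1%:R * falling_binomial F (a + 1) m.+1 = (a + 1)%:~R * falling_binomial F a m.
Proof.
rewrite /falling_binomial big_ord_recl subr0 factS natrM.
have -> : \prod_(i < m) ((a + 1)%:~R - (lift ord0 i)%:R)
    = \prod_(i < m) (a%:~R - i%:R) :> F.
  apply: eq_bigr => i _.
  by rewrite lift0 intrD -natr1 opprD addrACA subrr addr0.
have m0 : m.+1%:R != 0 :> F by rewrite pnatr_eq0.
have f0 : m`!%:R != 0 :> F by rewrite pnatr_eq0 -lt0n fact_gt0.
move: (m.+1%:R) m0 => M m0; field; exact/andP.
Qed.

Lemma falling_binomialS (F : numFieldType) (a : int) (m : nat) :
  falling_binomial F (a + 1) m.+1
    = falling_binomial F a m.+1 + falling_binomial F a m.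
Proof.
have m0 : m.+1%:R != 0 :> F by rewrite pnatr_eq0.
apply: (mulfI m0); rewrite falling_binomial_absorption mulrDr.
suff -> : m.+1%:R * falling_binomial F a m.+1
    = (a%:~R - m%:R) * falling_binomial F a m by rewrite intrD mulrSr; ring.
rewrite /falling_binomial big_ord_recr /= factS natrM.
have f0 : m`!%:R != 0 :> F by rewrite pnatr_eq0 -lt0n fact_gt0.
move: (m.+1%:R) m0 => M m0; field; exact/andP.
Qed.

Lemma falling_binomial_nat (F : numFieldType) (n m : nat) :
  falling_binomial F n m = 'C(n, m)%:R.
Proof.
elim: n m => [|n IH] [|m]; rewrite ?falling_binomial0 ?bin0 //.
  by rewrite /falling_binomial big_ord_recl /= subr0 !mul0r.
by rewrite -addn1 PoszD falling_binomialS !IH addn1 binS natrD.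
Qed.

(** One term of the binomial expansion of [(1 + y) ^+ n]. *)
Lemma bin_le_expr (F : numFieldType) (y : F) (n m : nat) :
  0 <= y -> 'C(n, m)%:R * y ^+ m <= (1 + y) ^+ n.
Proof.
move=> y0; case: (leqP m n) => [mn|nm]; last first.
  by rewrite bin_small // mul0r exprn_ge0 // addr_ge0.
rewrite exprDn (bigD1 (Ordinal (mn : m < n.+1)%N)) //=.
rewrite expr1n mul1r mulr_natl lerDl sumr_ge0 // => i _.
by rewrite mulrn_wge0 // expr1n mul1r exprn_ge0.
Qed.

(** * Null solutions of the recurrence *)

(** Beyond some [N] the values have modulus at most [e]; averaging carries
    this bound backwards, one index at a time, down to the index 0. *)
Lemma backward_average_eq0 (R : realType) (k : nat) (c : 'I_k -> R) (E : R^nat) :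
  (forall i, 0 <= c i) -> 0 < \sum_(i < k) c i ->
  (forall s, (\sum_(i < k) c i) * E s = \sum_(i < k) c i * E (s + i.+1)%N) ->
  E @ \oo --> 0 -> forall s, E s = 0.
Proof.
move=> c0 sc avg E0 s; apply/eqP; rewrite -normr_le0; apply/ler_addgt0Pl => e e0.
rewrite addr0.
have [N _ EN] : \forall t \near \oo, `|E t| <= e.
  by move/cvgr0Pnorm_le : E0; apply.
suff down j t : (N <= t + j)%N -> `|E t| <= e by apply: (down N); rewrite leq_addl.
elim: j t => [t|j IH t] Nt; first by apply: EN => /=; rewrite addn0 in Nt.
have [Nt'|/ltnW tN] := leqP N (t + j); first exact: IH.
rewrite -(ler_pM2l sc) -[X in X * `|_|]gtr0_norm // -normrM avg.
apply: (le_trans (ler_norm_sum _ _ _)); rewrite mulr_suml.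
apply: ler_sum => i _; rewrite normrM ger0_norm //.
by apply: ler_wpM2l => //; apply: IH; lia.
Qed.

(** The other roots of [z ^+ k.+1 - 2 * z + 1] have modulus at least 1, so
    only the geometric solution of ratio [b] tends to 0. Rather than solving
    the recurrence, factor [z - b] out of it: the remaining recurrence, on
    [V s.+1 - b * V s], is an average with positive weights. *)
Lemma null_trinomial_recurrence (R : realType) (k : nat) (b : R) (V : R^nat) :
  0 < b -> \sum_(i < k) b ^+ i.+1 = 1 ->
  (forall s, V (s + k.+1)%N = 2 * V s.+1 - V s) ->
  V @ \oo --> 0 -> forall s, V s = V 0%N * b ^+ s.
Proof.
move=> b0 sb Vrec V0.
pose E s := V s.+1 - b * V s.
suff E0 s : E s = 0.
  elim=> [|s IH]; first by rewrite mulr1.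
  by rewrite exprS mulrCA -IH; apply/eqP; rewrite -subr_eq0 -/(E s) E0.
have sc := geometric_root_weights _ _ _ (lt0r_neq0 b0) sb.
have bk := geometric_root_trinomial _ _ _ sb.
(* Each [E] is a step of [V], so the weighted sum collapses. *)
have telescope m t : \sum_(i < m) b ^+ (m.-1 - i) * E (t + i)%N
    = V (t + m)%N - b ^+ m * V t.
  elim: m => [|m IH]; first by rewrite big_ord0 addn0 mul1r subrr.
  rewrite big_ord_recr /= subnn mul1r.
  rewrite (eq_bigr (fun i : 'I_m => b * (b ^+ (m.-1 - i) * E (t + i)%N))).
    by rewrite -mulr_sumr IH /E addnS exprS; ring.
  by move=> i _; rewrite mulrA -exprS; congr (b ^+ _ * _); case: i => i /=; lia.
move: s; apply: (@backward_average_eq0 _ k (fun i => b ^+ (k.-1 - i))).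
- by move=> i; rewrite exprn_ge0 // ltW.
- have [|k0] := posnP k.
    by move=> k0; move: sb; rewrite k0 big_ord0 => /eqP; rewrite eq_sym oner_eq0.
  rewrite (lt_le_trans (exprn_gt0 k.-1 b0)) // (bigD1 (Ordinal k0)) //= subn0.
  by rewrite lerDl sumr_ge0 // => i _; rewrite exprn_ge0 // ltW.
- move=> s; rewrite sc.
  have := telescope k.+1 s; rewrite big_ord_recl Vrec bk /= subn0 addn0 => h.
  rewrite (eq_bigr (fun i : 'I_k => b ^+ (k - lift ord0 i) * E (s + lift ord0 i)%N)).
    by apply: (addrI (b ^+ k * E s)); rewrite h /E; ring.
  by move=> i _; rewrite lift0 -subn1 -subnDA add1n.
- rewrite (_ : 0 = 0 - b * 0); last by rewrite mulr0 subrr.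
  apply: cvgB; first by rewrite (cvg_shiftS V).
  exact: cvgMr.
Qed.

(** * The binomial series *)

Definition binom_term (R : realType) (k : nat) (s : int) : R^nat :=
  fun l => falling_binomial R (k.+1%:Z * l%:Z + s) l * 2 ^- (k.+1 * l).

Lemma binom_term0 (R : realType) (k : nat) (s : int) : binom_term R k s 0 = 1.
Proof. by rewrite /binom_term falling_binomial0 muln0 expr0 invr1 mulr1. Qed.

Lemma binom_term_pascal (R : realType) (k : nat) (s : int) (l : nat) :
  binom_term R k (s + 1) l.+1
    = binom_term R k s l.+1 + 2 ^- k.+1 * binom_term R k (s + k.+1%:Z) l.
Proof.
rewrite /binom_term addrA falling_binomialS mulrDl mulnS exprD invfM.
have -> : (k.+1%:Z * l%:Z + (s + k.+1%:Z) = k.+1%:Z * l.+1%:Z + s)%R by lia.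
by ring.
Qed.

Lemma binom_term_absorption (R : realType) (k : nat) (l : nat) :
  binom_term R k 0 l.+1 = k.+1%:R * 2 ^- k.+1 * binom_term R k k%:Z l.
Proof.
rewrite /binom_term mulnS exprD invfM.
have -> : (k.+1%:Z * l.+1%:Z + 0 = k.+1%:Z * l%:Z + k%:Z + 1)%R by lia.
suff -> : falling_binomial R (k.+1%:Z * l%:Z + k%:Z + 1) l.+1
    = k.+1%:R * falling_binomial R (k.+1%:Z * l%:Z + k%:Z) l by ring.
have l0 : l.+1%:R != 0 :> R by rewrite pnatr_eq0.
apply: (mulfI l0); rewrite falling_binomial_absorption.
have -> : (k.+1%:Z * l%:Z + k%:Z + 1 = (l.+1 * k.+1)%N%:Z)%R by lia.
by rewrite -pmulrn natrM -[LHS]mulrA.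
Qed.

(** [bin_le_expr] at [y = 1/2] bounds the term by
    (3/2)^s (2 (3/4)^k.+1)^l, and the ratio is at most 27/32 since k >= 2. The
    value 1/2 is chosen so that (1 + y) / 2 = 3/4 is less than 1, which forces
    the sum divided by 2^s to tend to 0, while the ratio stays below 1. *)
Lemma binom_term_bound (R : realType) (k s l : nat) : (2 <= k)%N ->
  0 <= binom_term R k s%:Z l <= geometric ((3 / 2) ^+ s) (27 / 32) l.
Proof.
move=> hk; rewrite /binom_term -PoszM -PoszD falling_binomial_nat /geometric /=.
rewrite divr_ge0 ?exprn_ge0 //=.
have y0 : 0 <= 2^-1 :> R by rewrite invr_ge0.
have := bin_le_expr _ _ (k.+1 * l + s) l y0; rewrite exprVn ler_pdivrMr ?exprn_gt0 //.
move=> /(ler_wpM2r (_ : 0 <= 2 ^- (k.+1 * l) :> R)).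
rewrite invr_ge0 exprn_ge0 // => /(_ isT) /le_trans; apply.
have -> : 1 + 2^-1 = 3 / 2 :> R by field.
have split_powers (a c : R) : a ^+ (k.+1 * l + s) * c ^+ l * c ^- (k.+1 * l)
    = a ^+ s * (c * (a / c) ^+ k.+1) ^+ l.
  rewrite exprD !exprM expr_div_n !exprMn exprVn.
  by rewrite [_ * a ^+ s]mulrC -!mulrA [_ ^+ l * (c ^+ l * _)]mulrCA.
rewrite split_powers (_ : 3 / 2 / 2 = 3 / 4 :> R); last by field.
have -> : 27 / 32 = 2 * (3 / 4) ^+ 3 :> R by field.
have q0 : 0 <= 3 / 4 :> R by lra.
rewrite ler_wpM2l ?exprn_ge0 //.
by rewrite lerXn2r ?nnegrE ?mulr_ge0 ?exprn_ge0 // ler_wpM2l // ler_wiXn2l //; lra.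
Qed.

Lemma cvg_binom_series (R : realType) (k s : nat) : (2 <= k)%N ->
  cvgn (series (binom_term R k s%:Z)).
Proof.
move=> hk; have bd l := andP (binom_term_bound R k s l hk).
apply: (@series_le_cvg _ _ (geometric ((3 / 2) ^+ s) (27 / 32))).
- by move=> l; case: (bd l).
- by move=> l; case: (bd l) => t0 tg; exact: le_trans t0 tg.
- by move=> l; case: (bd l).
- by apply: is_cvg_geometric_series; rewrite ger0_norm; lra.
Qed.

(** The factor 32/5 is the sum of the geometric series of ratio 27/32. *)
Lemma lim_binom_series_bound (R : realType) (k s : nat) : (2 <= k)%N ->
  0 <= limn (series (binom_term R k s%:Z)) <= (3 / 2) ^+ s * (32 / 5).
Proof.
move=> hk; have bd l := andP (binom_term_bound R k s l hk).
have q1 : `|27 / 32| < 1 :> R by rewrite ger0_norm; lra.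
have -> : (3 / 2) ^+ s * (32 / 5) = limn (series (geometric ((3 / 2) ^+ s : R) (27 / 32))).
  rewrite (cvg_lim _ (cvg_geometric_series q1)) //.
  by congr (_ * _); field.
apply/andP; split.
  apply: limr_ge; first exact: cvg_binom_series.
  by apply: nearW => N; apply: sumr_ge0 => l _; case: (bd l).
apply: lim_series_le; [exact: cvg_binom_series| |by move=> l; case: (bd l)].
exact: is_cvg_geometric_series.
Qed.

(** Transfers to sums a termwise identity in which one of the series is
    shifted by one index, as Pascal's rule and absorption produce. *)
Lemma cvg_series_shift (R : realType) (f g h : R^nat) (x a b : R) :
  f 0%N = g 0%N -> (forall l, f l.+1 = g l.+1 + x * h l) ->
  series g @ \oo --> a -> series h @ \oo --> b ->
  series f @ \oo --> a + x * b.
Proof.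
move=> e0 eS ga hb.
have -> : series f = series g \+ (fun N => x * series h N.-1).
  apply/funext => -[|N] /=; first by rewrite !seriesEnat /= !big_geq // mulr0 addr0.
  rewrite !seriesEnat /= !big_nat_recl //= e0 -addrA mulr_sumr -big_split /=.
  by congr (_ + _); apply: eq_bigr => l _; rewrite eS.
apply: cvgD => //; apply: cvgMr; rewrite -cvg_shiftS; exact: hb.
Qed.

(** The sums divided by [2 ^+ s] satisfy the trinomial recurrence by Pascal's
    rule, and tend to 0 like [(3 / 4) ^+ s]. *)
Lemma binom_series_nat (R : realType) (k : nat) (b : R) : (2 <= k)%N ->
  0 < b -> \sum_(i < k) b ^+ i.+1 = 1 ->
  exists T : R, forall s : nat,
    series (binom_term R k s%:Z) @ \oo --> T * (2 * b) ^+ s.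
Proof.
move=> hk b0 sb.
pose T (s : nat) := limn (series (binom_term R k s%:Z)).
have cT s : series (binom_term R k s%:Z) @ \oo --> T s by exact: cvg_binom_series.
have Trec s : T s.+1 = T s + 2 ^- k.+1 * T (s + k.+1)%N.
  apply: cvg_lim => //.
  apply: cvg_series_shift (cT s) (cT (s + k.+1)%N); first by rewrite !binom_term0.
  by move=> l; rewrite -addn1 !PoszD binom_term_pascal.
pose V s := T s / 2 ^+ s.
have p0 s : 2 ^+ s != 0 :> R by rewrite expf_neq0.
have Vrec s : V (s + k.+1)%N = 2 * V s.+1 - V s.
  rewrite /V Trec exprD [2 ^+ s.+1]exprS.
  by move: (p0 s) (p0 k.+1) => ps pk; field; rewrite ps pk.
have V0 : V @ \oo --> 0.
  apply: (@squeeze_cvgr _ _ _ _ (fun=> 0) (geometric (32 / 5) (3 / 4))).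
  - apply: nearW => s; have /andP[T0 Ts] := lim_binom_series_bound R k s hk.
    rewrite divr_ge0 ?exprn_ge0 //= ler_pdivrMr ?exprn_gt0 //.
    apply: (le_trans Ts); rewrite -mulrA -exprMn mulrC.
    by rewrite (_ : 3 / 4 * 2 = 3 / 2 :> R) //; field.
  - exact: cvg_cst.
  - by apply: cvg_geometric; rewrite ger0_norm; lra.
exists (T 0%N) => s; suff <- : T s = T 0%N * (2 * b) ^+ s by exact: cT.
have := null_trinomial_recurrence _ _ _ _ b0 sb Vrec V0 s.
rewrite {2}/V expr0 divr1 exprMn => Vs.
by rewrite mulrCA -Vs /V mulrC divfK.
Qed.

(** For negative [s] some terms may be negative and the bound above does not
    apply; Pascal's rule solved for the term at [s] reduces to the larger
    values [s + 1] and [s + k.+1]. The equation on [T] comes from absorption at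
    [s = 0], which relates the sums at 0 and at [k]. *)
Lemma binom_series_int (R : realType) (k : nat) (b : R) : (2 <= k)%N ->
  0 < b -> \sum_(i < k) b ^+ i.+1 = 1 ->
  exists2 T : R, T * (k.+1%:R - 2 * k%:R * b) = 2 * b &
    forall s : int, series (binom_term R k s) @ \oo --> T * (2 * b) ^ s.
Proof.
move=> hk b0 sb; have [T cT] := binom_series_nat R k b hk b0 sb.
have bk := geometric_root_trinomial _ _ _ sb.
have bb0 : 2 * b != 0 by rewrite mulf_neq0 // gt_eqF.
have p0 : 2 ^+ k.+1 != 0 :> R by rewrite expf_neq0.
exists T.
  have eT : T = 1 + k.+1%:R * 2 ^- k.+1 * (T * (2 * b) ^+ k).
    rewrite -[LHS]mulr1; apply: (cvg_unique _ (cT 0%N)) => //.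
    (* [g] supplies the term of index 0, which absorption does not reach. *)
    pose g (l : nat) : R := (l == 0%N)%:R.
    have cg : series g @ \oo --> (1 : R).
      rewrite -cvg_shiftS; apply: cvg_near_cst; apply: nearW => N /=.
      by rewrite seriesEnat /= big_nat_recl //= big1 ?addr0.
    apply: cvg_series_shift cg (cT k); first by rewrite binom_term0.
    by move=> l; rewrite binom_term_absorption add0r.
  have : T * (2 * b) = 2 * b + k.+1%:R * T * b ^+ k.+1.
    rewrite {1}eT mulrDl mul1r exprMn !exprS; congr (_ + _).
    have : 2 ^+ k != 0 :> R by rewrite expf_neq0.
    by move=> pk; field.
  rewrite bk -natr1 => /eqP; rewrite -subr_eq0 => /eqP h.
  by apply/eqP; rewrite -subr_eq0 -h; apply/eqP; ring.
suff H n : forall s : int, - n%:Z <= s ->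
    series (binom_term R k s) @ \oo --> T * (2 * b) ^ s.
  by move=> s; apply: (H `|s|%N); lia.
elim: n => [|n IH] s sn; first by have -> : s = `|s|%N by lia.
have [sn'|ns] := leP (- n%:Z) s; first exact: IH.
have -> : T * (2 * b) ^ s
    = T * (2 * b) ^ (s + 1) + (- 2 ^- k.+1) * (T * (2 * b) ^ (s + k.+1%:Z)).
  have ek : (2 * b) ^ k.+1%:Z = 2 ^+ k.+1 * (2 * b - 1).
    by rewrite -exprnP exprMn bk.
  by rewrite !expfzDr // expr1z ek; field.
apply: cvg_series_shift (IH (s + 1) _) (IH (s + k.+1%:Z) _); try lia.
  by rewrite !binom_term0.
by move=> l; rewrite binom_term_pascal; ring.
Qed.

(** * Evaluation of the closed form *)

Lemma As_geometric_root (R : realType) (k n : nat) (b : R) :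
  (2 <= k)%N -> 0 < b -> b < 1 -> \sum_(i < k) b ^+ i.+1 = 1 ->
  As R k n
    = ((b^-1 - 1) / (k.+1%:R * b^-1 - (2 * k)%:R) * b^-1 ^ (n%:Z - 1))%:C%C.
Proof.
move=> hk b0 b1 sb; rewrite /As (rho_geometric_root _ _ _ hk b0 b1 sb).
pose c : {rmorphism R -> R[i]} := real_complex R.
rewrite -!/(c _) !(rmorphM c) fmorphXz !(fmorphV c) !(rmorphB c) rmorphM.
by rewrite !rmorph_nat rmorph1 fmorphV.
Qed.

Lemma gbinomial_nat (F : fieldType) (a : int) (l : nat) :
  gbinomial F a l%:Z = falling_binomial F a l.
Proof. by []. Qed.

(** For [n = 0] the symmetric clause of the definition applies and gives
    C(0, 1) = 0; for [n >= 2] the upper index lies below the lower one. For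
    [n = 1] the value would be 1. *)
Lemma gbinomialN1 (F : fieldType) (n : nat) : n <> 1%N ->
  gbinomial F (- n%:Z) (- 1) = 0.
Proof.
move=> hn; rewrite /gbinomial /=; case: ifP => // n1.
have -> : n = 0%N by lia.
by rewrite /falling_binomial big_ord_recl /= subrr !mul0r.
Qed.

Theorem theorem3p6 (R : realType) (k n : nat) (hk : (2 <= k)%N) (hn : n <> 1%N) :
  let u : R^nat := fun l : nat =>
    (gbinomial R (k.+1%:Z * l%:Z - n%:Z) l%:Z
     - gbinomial R (k.+1%:Z * l%:Z - n%:Z) (l%:Z - 1))
    * 2 ^- (k.+1 * l) in
  cvgn (series u) /\
  As R k n = (2 ^ (n%:Z - 2) * limn (series u))%:C%C.
Proof.
move=> u; have [b [b0 b1 sb]] := geometric_root_exists R k hk.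
have [T eT cT] := binom_series_int R k b hk b0 sb.
have bk := geometric_root_trinomial _ _ _ sb.
have bb0 : 2 * b != 0 by rewrite mulf_neq0 // gt_eqF.
have p0 : 2 ^+ k.+1 != 0 :> R by rewrite expf_neq0.
have u0 : u 0%N = binom_term R k (- n%:Z) 0.
  rewrite /u mulr0 sub0r add0r gbinomialN1 // gbinomial_nat subr0.
  by rewrite /binom_term mulr0 add0r.
have uS l : u l.+1 = binom_term R k (- n%:Z) l.+1
    + (- 2 ^- k.+1) * binom_term R k (- n%:Z + k.+1%:Z) l.
  rewrite /u (_ : l.+1%:Z - 1 = l%:Z :> int); last by lia.
  rewrite !gbinomial_nat /binom_term [in X in _ - X](_ : k.+1%:Z * l.+1%:Z - n%:Z
    = k.+1%:Z * l%:Z + (- n%:Z + k.+1%:Z) :> int); last by lia.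
  by rewrite mulnS exprD invfM; ring.
have ulim := cvg_series_shift _ _ _ _ _ _ _ u0 uS (cT _) (cT _).
split; first by apply/cvg_ex; eexists; exact: ulim.
rewrite (As_geometric_root R k n b) // (cvg_lim _ ulim) //; congr (_%:C%C).
have ek : (2 * b) ^ k.+1%:Z = 2 ^+ k.+1 * (2 * b - 1).
  by rewrite -exprnP exprMn bk.
have d0 : k.+1%:R - 2 * k%:R * b != 0.
  by apply: contraNneq bb0 => d; rewrite -eT d mulr0.
have -> : T = 2 * b / (k.+1%:R - 2 * k%:R * b) by rewrite -eT mulfK.
have b0' := lt0r_neq0 b0.
rewrite !expfzDr // ?invr_eq0 // ek expfzMl !exprz_inv opprK natrM.
have q0 : 2 ^ n%:Z != 0 :> R by rewrite expfz_neq0.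
have bn0 : b ^ n%:Z != 0 by rewrite expfz_neq0.
rewrite -!invr_expz expr1z.
move: (2 ^+ k.+1) (2 ^ n%:Z) (b ^ n%:Z) p0 q0 bn0 => P Q B P0 Q0 B0.
move: (k.+1%:R) d0 => K d0.
by rewrite -exprnP; field; rewrite B0 Q0 d0 P0 b0'.
Qed.
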